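(* The SRPT-$k$ algorithm is a $4$-approximation for mean response time when all jobs arrive at time $0$. That is, for every number $k\ge1$ of processors, and every finite set of jobs $1,\dots,n$ with known sizes $x_j>0$ and parallelizability bounds $0<k_j\le k$, all available at time $0$, the total (equivalently, mean) response time of the SRPT-$k$ schedule is at most $4$ times the minimum total (mean) response time over all feasible schedules.
   Context: Setting. There are $k$ identical unit-speed processors and $n$ jobs, all released at time $0$. Job $j$ has known inherent size (work) $x_j$ and is parallelizable up to $k_j$ processors: if it is given $k'\le k$ processors it is processed at rate $\min\{k_j,k'\}$. (Inelastic jobs have $k_j=1$, elastic jobs have $k_j=k$.) At each time the total number of processors allocated is at most $k$; allocations may be fractional and may change over time (preemption is allowed). A job completes when it has received $x_j$ units of processing; since all jobs arrive at time $0$, its response time equals its completion time. SRPT-$k$ (generalized to parallelizable jobs). Sort the jobs by inherent size so that $x_1\le x_2\le\dots\le x_n$. At every time, go through the unfinished jobs in this fixed priority order, giving each job $j$ up to $k_j$ processors (i.e. the minimum of $k_j$ and the number of processors still unassigned), and pass the remaining processors to the next job in the list. *)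

(* Defs.v *)
From HB Require Import structures.
From mathcomp Require Import all_boot all_order all_algebra all_fingroup.
From mathcomp Require Import all_classical all_reals all_analysis.

Set Implicit Arguments.
Unset Strict Implicit.
Unset Printing Implicit Defensive.

Import Order.TTheory GRing.Theory Num.Theory.
Import numFieldNormedType.Exports.

Local Open Scope classical_set_scope.
Local Open Scope ring_scope.

Section Scheduling.
Context {R : realType} {n : nat}.

(* [a j t] is the (possibly fractional) number of processors given to job [j]
   at time [t]; values at negative times are irrelevant. *)
Definition schedule := 'I_n -> R -> R.

Implicit Types (k : nat) (x par : 'I_n -> R) (a : schedule) (j : 'I_n) (t : R).

(* Measurability is what gives the processed work a meaning; nothing forces a
   schedule to finish its jobs, see [completion_time]. *)
Definition feasible k a : Prop :=
  [/\ forall j, measurable_fun (`[0, +oo[ : set R) (a j),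
      forall j t, 0 <= t -> 0 <= a j t &
      forall t, 0 <= t -> \sum_(j < n) a j t <= k%:R].

(* [par j] is the parallelizability bound of job [j]. *)
Definition rate par a j t : R := Num.min (par j) (a j t).

Definition work par a j t : \bar R :=
  (\int[lebesgue_measure]_(s in `[0%R, t]) (rate par a j s)%:E)%E.

Definition unfinished x par a j t : Prop := (work par a j t < (x j)%:E)%E.

(* Equal to +oo when the job is never completed (infimum of the empty set).
   All jobs are released at time 0, so this is also the response time. *)
Definition completion_time x par a j : \bar R :=
  ereal_inf [set t%:E | t in [set t | 0 <= t /\ ~ unfinished x par a j t]].

Definition total_response x par a : \bar R :=
  (\sum_(j < n) completion_time x par a j)%E.

Definition mean_response x par a : \bar R :=
  ((n%:R^-1)%:E * total_response x par a)%E.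

Definition optimum k (cost : schedule -> \bar R) : \bar R :=
  ereal_inf [set cost b | b in feasible k].

(* [p i] is the job of rank [i]; ties between equal sizes are broken
   arbitrarily. *)
Definition by_size x (p : {perm 'I_n}) : Prop :=
  forall i i' : 'I_n, (i <= i')%N -> x (p i) <= x (p i').

(* Processors left by the jobs of rank less than [i]; finished jobs hold none
   under [is_SRPT]. *)
Definition unassigned k (p : {perm 'I_n}) a (i : 'I_n) t : R :=
  k%:R - \sum_(l < n | (l < i)%N) a (p l) t.

(* The rule refers to the set of jobs unfinished at time [t], which depends on
   the schedule itself up to time [t]: an SRPT-k schedule is a solution of this
   system. *)
Definition is_SRPT k x par a : Prop :=
  feasible k a /\
  exists2 p : {perm 'I_n}, by_size x p &
    forall (i : 'I_n) t, 0 <= t ->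
      (unfinished x par a (p i) t ->
         a (p i) t = Num.min (par (p i)) (unassigned k p a i t)) /\
      (~ unfinished x par a (p i) t -> a (p i) t = 0).

End Scheduling.

Arguments schedule : clear implicits.

(* Main.v *)
(* While job j is unfinished under SRPT-k, either it runs at its full rate k_j or
   the jobs of rank at most j keep all k processors busy; hence
     C_j <= x_j / k_j + (1/k) * sum_{i <= j} x_i.
   Summing over j, each of the two resulting sums is a lower bound for the total
   response time of any feasible schedule: the first one because no job can run
   faster than k_j, the second one because the jobs completed no later than C_j
   need total work at most k C_j, and the order by size minimizes the resulting
   double sum.  This even gives the factor 2.
   An SRPT-k schedule is built rank by rank: each job is offered its share of the
   processors left by the earlier ranks until it is completed. *)

Require Import Defs.
From HB Require Import structures.
From mathcomp Require Import all_boot all_order all_algebra all_fingroup.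
From mathcomp Require Import all_classical all_reals all_analysis.
From mathcomp Require Import measurable_realfun.
From mathcomp Require Import ring lra.

Set Implicit Arguments.
Unset Strict Implicit.
Unset Printing Implicit Defensive.

Import Order.TTheory GRing.Theory Num.Theory.
Import numFieldNormedType.Exports.

Local Open Scope classical_set_scope.
Local Open Scope ring_scope.

(** * Cumulative integrals of bounded nonnegative rates *)

Section Cumul.
Context {R : realType}.
Implicit Types (f g : R -> R) (M s t y : R).

(** [work par a j] is convertible to [cumul (rate par a j)], so the lemmas on [cumul] apply to work
    directly. *)
Definition cumul f t : \bar R :=
  (\int[lebesgue_measure]_(s in `[0%R, t]) (f s)%:E)%E.

Definition rate_fun M f : Prop :=
  measurable_fun (`[0, +oo[ : set R) f /\ forall t, 0 <= t -> 0 <= f t <= M.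

Lemma rate_fun_meas M f t : rate_fun M f ->
  measurable_fun (`[0, t] : set R) (fun s => (f s)%:E).
Proof.
move=> [mf _]; apply/measurable_EFinP; apply: measurable_funS mf => //.
by move=> s /=; rewrite !in_itv/= andbT => /andP[].
Qed.

Lemma le_cumul_fun M N f g t : rate_fun M f -> rate_fun N g ->
  (forall s, 0 <= s <= t -> f s <= g s) -> (cumul f t <= cumul g t)%E.
Proof.
move=> rf rg fg; apply: ge0_le_integral => //.
- by move=> s /=; rewrite in_itv/= lee_fin => /andP[s0 _]; case/andP: (rf.2 s s0).
- exact: (rate_fun_meas rf).
- exact: (rate_fun_meas rg).
Qed.

Lemma eq_cumul f g t : (forall s, 0 <= s <= t -> f s = g s) ->
  cumul f t = cumul g t.
Proof.
by move=> fg; apply: eq_integral => s; rewrite inE/= in_itv/= => /fg ->.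
Qed.

Lemma cumul_cst (c : R) t : 0 <= t -> cumul (cst c) t = (c * t)%:E.
Proof.
move=> t0; rewrite [LHS](_ : _ = \int[lebesgue_measure]_(s in `[0%R, t]) cst c%:E s)%E//.
rewrite integral_cst//= lebesgue_measure_itv/= lte_fin.
case: ltP => [_|t0']; first by rewrite sube0 EFinM.
by rewrite (_ : t = 0) ?mule0 ?mulr0//; apply/eqP; rewrite eq_le t0 t0'.
Qed.

Lemma rate_fun_cst (c : R) : 0 <= c -> rate_fun c (cst c).
Proof. by move=> c0; split=> [|t _]; [exact: measurable_cst|rewrite c0/=]. Qed.

Lemma cumul_le_cst M f t : rate_fun M f -> 0 <= t -> (cumul f t <= (M * t)%:E)%E.
Proof.
move=> rf t0; rewrite -cumul_cst//; apply: (le_cumul_fun rf).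
  by apply: rate_fun_cst; case/andP: (rf.2 0 (lexx _)) => /le_trans; apply.
by move=> s /andP[s0 _]; case/andP: (rf.2 s s0).
Qed.

Lemma cumul_ge0 M f t : rate_fun M f -> (0 <= cumul f t)%E.
Proof.
move=> rf; apply: integral_ge0 => s /=; rewrite in_itv/= lee_fin => /andP[s0 _].
by case/andP: (rf.2 s s0).
Qed.

Lemma cumul_fin_num M f t : rate_fun M f -> 0 <= t -> cumul f t \is a fin_num.
Proof.
move=> rf t0; rewrite ge0_fin_numE ?(cumul_ge0 _ rf)//.
by apply: le_lt_trans (cumul_le_cst rf t0) _; rewrite ltry.
Qed.

Lemma le_cumul M f s t : rate_fun M f -> s <= t -> (cumul f s <= cumul f t)%E.
Proof.
move=> rf st; apply: ge0_subset_integral => //.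
- exact: (rate_fun_meas rf).
- by move=> u /=; rewrite in_itv/= lee_fin => /andP[u0 _]; case/andP: (rf.2 u u0).
- by apply: subset_itvl; rewrite bnd_simp.
Qed.

(** Boundedness makes [f] integrable on [[0, t]], so its integral is continuous and the intermediate
    value theorem applies. *)
Lemma cumul_ivt M f t y : rate_fun M f -> 0 <= t -> 0 <= y ->
  (y%:E <= cumul f t)%E -> exists2 s, 0 <= s <= t & cumul f s = y%:E.
Proof.
move=> rf t0 y0 yt.
have f0 : cumul f 0 = 0%E.
  have := cumul_le_cst rf (lexx 0); rewrite mulr0 => f0.
  by apply/le_anti; rewrite f0 (cumul_ge0 _ rf).
have intf : lebesgue_measure.-integrable `[0, t] (EFin \o f).
  apply: measurable_bounded_integrable => //.
  - by rewrite /= lebesgue_measure_itv/=; case: ifP => _; rewrite ?ltry// -EFinB ltry.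
  - by apply/measurable_EFinP; exact: (rate_fun_meas rf).
  - exists M; split; first exact: num_real.
    move=> N MN s /=; rewrite in_itv/= => /andP[s0 _].
    by case/andP: (rf.2 s s0) => fs0 fsM; rewrite ger0_norm// (le_trans fsM)// ltW.
have fine_cont : {within `[0, t], continuous (fun s => fine (cumul f s))}.
  exact: (parameterized_integral_continuous t0 intf).
have [|s + fs] := IVT (v := y) t0 fine_cont.
  rewrite f0/= ge_min y0/= le_max; apply/orP; right.
  by rewrite -lee_fin fineK// (cumul_fin_num rf).
rewrite in_itv/= => st; exists s => //.
by rewrite -fs fineK// (cumul_fin_num rf)//; case/andP: st.
Qed.

(** To exceed [y] at [t] the integral must equal [y] at some [s <= t]; but then [f] vanishes on []s,
    t]] and nothing more accumulates. *)
Lemma cumul_capped M f t y : rate_fun M f -> 0 <= t -> 0 <= y ->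
  (forall s, 0 <= s -> (y%:E <= cumul f s)%E -> f s = 0) ->
  (cumul f t <= y%:E)%E.
Proof.
move=> rf t0 y0 f0; rewrite leNgt; apply/negP => yt.
have [s /andP[s0 st] fs] := cumul_ivt rf t0 y0 (ltW yt).
move: yt; rewrite ltNge => /negP; apply.
have -> : cumul f t = (cumul f s + \int[lebesgue_measure]_(u in `]s, t]) (f u)%:E)%E.
  have E : `[0, t]%classic = (`[0, s] `|` `]s, t])%classic.
    by rewrite -itv_bndbnd_setU// bnd_simp.
  rewrite /cumul E ge0_integral_setU//.
  - by rewrite -E; exact: (rate_fun_meas rf).
  - rewrite -E => u /=; rewrite in_itv/= lee_fin => /andP[u0 _].
    by case/andP: (rf.2 u u0).
  - apply/disj_setPS => u [] /=; rewrite !in_itv/= => /andP[_ us] /andP[su _].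
    by move: us; rewrite leNgt su.
rewrite integral0_eq ?adde0 ?fs//.
move=> u /=; rewrite in_itv/= => /andP[su _]; rewrite f0 ?(le_trans s0 (ltW su))//.
by rewrite -fs (le_cumul rf)// ltW.
Qed.

(* Whether a job runs at time [t] depends on the work it has itself received;
   [cumul_stop_at] shows that testing the unstopped integral of [f] instead
   solves this fixed-point condition. *)
Definition stop_at y f : R -> R := fun t => if (cumul f t < y%:E)%E then f t else 0.

Lemma rate_fun_stop_at M f y : rate_fun M f -> rate_fun M (stop_at y f).
Proof.
move=> rf; split=> [|t t0]; last first.
  rewrite /stop_at; case: ifP => _; first exact: rf.2.
  by rewrite lexx; case/andP: (rf.2 t t0) => /le_trans; apply.
apply: measurable_fun_if => //.
(* The set where the test succeeds is an interval, since [cumul f] is nondecreasing. *)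
- apply: (measurable_fun_bool true); apply: is_interval_measurable.
  move=> s t [/= s0 _] [/= _ ty] u /andP[su ut].
  split; last by rewrite /=; apply: le_lt_trans ty; exact: (le_cumul rf).
  by move: s0; rewrite /= !in_itv/= !andbT => /le_trans; apply.
- by apply: measurable_funS rf.1 => // ? [].
Qed.

Lemma cumul_stop_at M f y t : rate_fun M f -> 0 <= t ->
  (cumul (stop_at y f) t < y%:E)%E = (cumul f t < y%:E)%E.
Proof.
move=> rf t0; have rg := rate_fun_stop_at y rf.
apply/idP/idP => [gy|]; last first.
  apply: le_lt_trans; apply: (le_cumul_fun rg rf) => s /andP[s0 _].
  by rewrite /stop_at; case: ifP => // _; case/andP: (rf.2 s s0).
rewrite ltNge; apply/negP => yt.
have gt := cumul_fin_num rg t0; have gt0 := cumul_ge0 t rg.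
move: gy gt0; rewrite -(fineK gt) lte_fin lee_fin; set v := fine _ => vy v0.
(* The unstopped integral passes the midpoint [z] at some [s <= t]. Up to [s] nothing has been
   stopped, so the stopped integral also reaches [z], above its later value [v]. *)
pose z := (v + y) / 2.
have vz : v < z by rewrite /z; lra.
have zy : z < y by rewrite /z; lra.
have [||s /andP[s0 st] fs] := cumul_ivt rf t0 (_ : 0 <= z).
- exact: le_trans v0 (ltW vz).
- by apply: le_trans yt; rewrite lee_fin ltW.
have gs : cumul (stop_at y f) s = z%:E.
  rewrite -fs; apply: eq_cumul => u /andP[u0 us]; rewrite /stop_at ifT//.
  by apply: le_lt_trans (le_cumul rf us) _; rewrite fs lte_fin.
have := le_cumul rg st.
by rewrite gs -(fineK gt) lee_fin leNgt vz.
Qed.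

Lemma cumul_lincomb (I : finType) (c M : I -> R) (f : I -> R -> R) t :
  (forall i, 0 <= c i) -> (forall i, rate_fun (M i) (f i)) ->
  cumul (fun s => \sum_i c i * f i s) t = (\sum_i (c i)%:E * cumul (f i) t)%E.
Proof.
move=> c0 rf; rewrite /cumul.
under eq_integral do rewrite -sumEFin.
rewrite ge0_integral_sum//=.
- apply: eq_bigr => i _; under eq_integral do rewrite EFinM.
  rewrite ge0_integralZl_EFin//; last exact: (rate_fun_meas (rf i)).
  move=> s /=; rewrite in_itv/= lee_fin => /andP[s0 _].
  by case/andP: ((rf i).2 s s0).
- move=> i; apply/measurable_EFinP/measurable_funM; first exact: measurable_cst.
  by apply/measurable_EFinP; exact: (rate_fun_meas (rf i)).
- move=> i s /=; rewrite in_itv/= lee_fin => /andP[s0 _].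
  by rewrite mulr_ge0//; case/andP: ((rf i).2 s s0).
Qed.

Lemma rate_fun_lincomb (I : finType) (c M : I -> R) (f : I -> R -> R) :
  (forall i, 0 <= c i) -> (forall i, rate_fun (M i) (f i)) ->
  rate_fun (\sum_i c i * M i) (fun s => \sum_i c i * f i s).
Proof.
move=> c0 rf; split=> [|t t0].
  apply: measurable_sum => i; apply: measurable_funM; first exact: measurable_cst.
  exact: (rf i).1.
have H i := (rf i).2 t t0.
apply/andP; split; first by apply: sumr_ge0 => i _; rewrite mulr_ge0//; case/andP: (H i).
by apply: ler_sum => i _; rewrite ler_wpM2l//; case/andP: (H i).
Qed.

End Cumul.

Section Scheduling.
Context {R : realType} {n : nat}.
Implicit Types (k : nat) (x par y : 'I_n -> R) (a b : schedule R n)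
  (p : {perm 'I_n}).

(** * Lower bounds on response times in an arbitrary feasible schedule *)

Lemma rate_fun_rate k par a j : 0 < par j -> feasible k a ->
  rate_fun (par j) (rate par a j).
Proof.
move=> p0 [ma a0 _]; split=> [|t t0].
  by apply: measurable_minr => //; exact: measurable_cst.
by rewrite /rate le_min ltW//= a0// ge_min lexx.
Qed.

Lemma finishedE x par a j t : ~ unfinished x par a j t <->
  ((x j)%:E <= work par a j t)%E.
Proof. by rewrite leNgt; split=> /negP. Qed.

Lemma completion_time_ge_span k x par b j : 0 < par j -> feasible k b ->
  ((x j / par j)%:E <= completion_time x par b j)%E.
Proof.
move=> p0 fb; apply: le_ereal_inf_tmp => _ [t [t0 /finishedE xw] <-].
rewrite lee_fin ler_pdivrMr// mulrC -lee_fin; apply: le_trans xw _.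
exact: cumul_le_cst (rate_fun_rate p0 fb) t0.
Qed.

Lemma completion_time_ge_load k x par b j : (1 <= k)%N ->
  (forall i, 0 < par i) -> feasible k b ->
  ((k%:R^-1 * \sum_(l | (completion_time x par b l <= completion_time x par b j)%E)
     x l)%:E <= completion_time x par b j)%E.
Proof.
move=> k1 p0 fb; have k0 : 0 < k%:R :> R by rewrite ltr0n.
apply: le_ereal_inf_tmp => _ [t [t0 xt] <-].
have Cjt : (completion_time x par b j <= t%:E)%E by apply: ereal_inf_lbound; exists t.
rewrite lee_fin mulrC ler_pdivrMr//; apply/ler_addgt0Pr => e e0.
(* A completion time is an infimum that is not shown to be attained, so the counted jobs are only
   known to be finished by [t + d]; this [d] makes the extra capacity exactly [e]. *)
pose d := e / k%:R; have d0 : 0 < d by rewrite divr_gt0.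
have -> : t * k%:R + e = k%:R * (t + d) by rewrite /d; field; rewrite gt_eqF.
have td0 : 0 <= t + d by rewrite addr_ge0// ltW.
have rb l := rate_fun_rate (p0 l) fb.
pose c l : R := (completion_time x par b l <= completion_time x par b j)%E%:R.
have c0 l : 0 <= c l by rewrite ler0n.
rewrite -lee_fin -cumul_cst//.
apply: (@le_trans _ _ (cumul (fun s => \sum_l c l * rate par b l s) (t + d))).
  rewrite (cumul_lincomb _ c0 rb) -sumEFin big_mkcond /=; apply: lee_sum => l _.
  rewrite /c; case: ifPn => [Clj|_]; last by rewrite mul0e.
  rewrite mul1e.
  have /ereal_inf_lt[_ [s [s0 /finishedE xs] <-]] :
      (completion_time x par b l < (t + d)%:E)%E.
    by apply: le_lt_trans (le_trans Clj Cjt) _; rewrite lte_fin ltrDl.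
  rewrite lte_fin => /ltW std; apply: le_trans xs _; exact: le_cumul (rb l) std.
apply: le_cumul_fun (rate_fun_lincomb c0 rb) (rate_fun_cst (ltW k0)) _.
move=> s /andP[s0 _]; have [_ b0 bk] := fb; apply: le_trans (bk s s0).
apply: ler_sum => l _; apply: (@le_trans _ _ (rate par b l s)).
  by rewrite ler_piMl//; [case/andP: ((rb l).2 s s0)|rewrite /c lern1 leq_b1].
by rewrite /rate ge_min lexx orbT.
Qed.

(* A pair [i < l] contributes [y i] to the left-hand side and at least
   [min (y i) (y l)] to the right-hand side, in one of the two orders. *)
Lemma sorted_order_minimal y (e : rel 'I_n) : (forall i, 0 <= y i) ->
  (forall i l : 'I_n, (i <= l)%N -> y i <= y l) -> total e ->
  \sum_(i < n) \sum_(l < n | (l <= i)%N) y l <= \sum_i \sum_(l | e l i) y l.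
Proof.
move=> y0 ymono etot.
(* Adding the sum to itself with indices exchanged puts both orders of a pair into one term, so the
   two sides can be compared term by term. *)
have sym (g : rel 'I_n) : (\sum_i \sum_(l | g l i) y l) *+ 2 =
    \sum_i \sum_l ((if g l i then y l else 0) + (if g i l then y i else 0)).
  have -> : \sum_i \sum_(l | g l i) y l = \sum_i \sum_l (if g l i then y l else 0).
    by apply: eq_bigr => i _; rewrite big_mkcond.
  rewrite mulr2n [X in _ + X = _]exchange_big -big_split.
  by apply: eq_bigr => i _; rewrite -big_split.
rewrite -(@ler_pMn2r _ 2)// !sym; apply: ler_sum => i _; apply: ler_sum => l _.
have := etot l i; have := y0 l; have := y0 i.
case: (ltngtP l i) => [/ltnW/ymono|/ltnW/ymono|/val_inj->].
- by case: (e l i); case: (e i l) => //=; lra.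
- by case: (e l i); case: (e i l) => //=; lra.
- by case: (e i i) => //=; lra.
Qed.

(** * Construction of an SRPT-k schedule *)

Lemma exists_by_size x : exists p : {perm 'I_n}, by_size x p.
Proof.
pose leT := relpre x <=%R.
have leT_total : total leT by move=> i l; exact: le_total.
have leT_trans : transitive leT by move=> i l m; exact: le_trans.
have [p ps] : exists p : {perm 'I_n},
    sort leT (ord_tuple n) = [tuple tnth (ord_tuple n) (p i) | i < n].
  by apply/tuple_permP; rewrite perm_sort.
exists p => i l il.
have := sorted_leq_nth leT_trans (fun u => lexx (x u)) i (sort_sorted leT_total (ord_tuple n)).
rewrite ps => /(_ i l); rewrite !inE size_tuple !ltn_ord => /(_ isT isT il).
by rewrite -!tnth_nth !tnth_mktuple !tnth_ord_tuple.
Qed.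

(** The rule of [is_SRPT] for a single rank and time, isolated so that it can be established rank by
    rank. *)
Definition serves k x par p a (i : 'I_n) t : Prop :=
  (unfinished x par a (p i) t ->
     a (p i) t = Num.min (par (p i)) (unassigned k p a i t)) /\
  (~ unfinished x par a (p i) t -> a (p i) t = 0).

Lemma unassigned_ge0 k p a i t : feasible k a -> 0 <= t ->
  0 <= unassigned k p a i t.
Proof.
move=> [_ a0 ak] t0; rewrite subr_ge0; apply: le_trans (ak t t0).
rewrite [leRHS](reindex_inj (@perm_inj _ p)) big_mkcond; apply: ler_sum => l _.
by case: ifP => // _; exact: a0.
Qed.

Lemma measurable_unassigned k p a i : feasible k a ->
  measurable_fun (`[0, +oo[ : set R) (unassigned k p a i).
Proof.
move=> [ma _ _]; apply: measurable_funB; first exact: measurable_cst.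
rewrite [X in measurable_fun _ X](_ : _ =
  (fun t => \sum_(l <- [seq l : 'I_n <- index_enum 'I_n | (l < i)%N]) a (p l) t)).
  by apply: measurable_sum => l; exact: ma.
by apply/funext => t; rewrite big_filter.
Qed.

(** Induction on [m]: the rule for a rank involves only that rank and the lower ones, so serving
    rank [m] disturbs nothing already built. Keeping ranks from [m] on idle makes the extension
    feasible. *)
Lemma exists_serves k x par p m : (forall j, 0 < x j) -> (forall j, 0 < par j) ->
  (m <= n)%N -> exists a, [/\ feasible k a,
    forall (i : 'I_n) t, (m <= i)%N -> a (p i) t = 0 &
    forall (i : 'I_n) t, (i < m)%N -> 0 <= t -> serves k x par p a i t].
Proof.
move=> x0 par0; elim: m => [_|m IH mn].
  exists (fun _ _ => 0); split=> //; split=> // t t0.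
  by rewrite big1.
have [a [fa az aserv]] := IH (ltnW mn).
pose i0 := Ordinal mn; pose j0 := p i0.
(* [r] is the share offered to rank [m] regardless of completion; [f] below cuts it off once the
   accumulated work reaches the size. *)
pose r := fun t => Num.min (par j0) (unassigned k p a i0 t).
have rr : rate_fun (par j0) r.
  split=> [|t t0]; last by rewrite le_min (ltW (par0 _)) (unassigned_ge0 p i0 fa t0) ge_min lexx.
  by apply: measurable_minr; [exact: measurable_cst|exact: measurable_unassigned].
pose f := stop_at (x j0) r.
have rf : rate_fun (par j0) f := rate_fun_stop_at (x j0) rr.
pose a' : schedule R n := fun j => if j == j0 then f else a j.
have a'j0 : a' j0 = f by rewrite /a' eqxx.
have a'E i : (i != i0) -> a' (p i) = a (p i).
  by move=> ii0; rewrite /a' (inj_eq perm_inj) (negbTE ii0).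
have unE (i : 'I_n) t : (i <= m)%N -> unassigned k p a' i t = unassigned k p a i t.
  move=> im; congr (_ - _); apply: eq_bigr => l li; rewrite a'E//.
  by rewrite -val_eqE/= ltn_eqF// (leq_trans li im).
have a'_ge0 j t : 0 <= t -> 0 <= a' j t.
  move=> t0; rewrite /a'; case: ifP => _; first by case/andP: (rf.2 t t0).
  by case: fa => _ a0 _; exact: a0.
have fr t : 0 <= t -> f t <= r t.
  by move=> t0; rewrite /f /stop_at; case: ifP => // _; case/andP: (rr.2 t t0).
exists a'; split.
- split=> // [j|t t0].
    rewrite /a'; case: ifP => _; first exact: rf.1.
    by case: fa.
  (* The total splits into ranks below [m], rank [m] and the idle later ranks; [f <= r] keeps rank
     [m] within what the lower ranks leave. *)
  rewrite (reindex_inj (@perm_inj _ p)) /= (bigID (fun l : 'I_n => (l < m)%N)) /=.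
  rewrite [X in _ + X](bigD1 i0) ?ltnn//= [X in _ + (_ + X)]big1 ?addr0.
    rewrite -lerBrDl -/j0 a'j0; apply: le_trans (fr t t0) _.
    rewrite /r ge_min -(unE i0)// /unassigned orbC.
    by rewrite lexx.
  move=> l /andP[lm li0]; rewrite a'E// az// ltnW// ltn_neqAle leqNgt lm andbT.
  by rewrite eq_sym.
- move=> i t mi; rewrite a'E ?az//; first exact: ltnW.
  by rewrite -val_eqE/= gtn_eqF.
- move=> i t; rewrite ltnS leq_eqVlt => /predU1P[im t0|im t0].
    have -> : i = i0 by apply/val_inj.
    have wE : work par a' j0 t = cumul f t.
      apply: eq_cumul => s /andP[s0 _]; rewrite /rate a'j0 min_r//.
      by case/andP: (rf.2 s s0).
    rewrite /serves /unfinished -/j0 wE (cumul_stop_at _ rr t0) a'j0 unE//.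
    by split=> [|/negP/negbTE] h; rewrite /f /stop_at h.
  have ii0 : i != i0 by rewrite -val_eqE/= ltn_eqF.
  have wE : work par a' (p i) t = work par a (p i) t.
    by rewrite /work /rate a'E.
  have := aserv i t im t0.
  by rewrite /serves /unfinished wE a'E// unE// ltnW.
Qed.

Lemma exists_SRPT k x par : (forall j, 0 < x j) -> (forall j, 0 < par j) ->
  exists a, is_SRPT k x par a.
Proof.
move=> x0 par0; have [p px] := exists_by_size x.
have [a [fa _ serv]] := exists_serves k p x0 par0 (leqnn n).
by exists a; split=> //; exists p => // i t t0; exact: serv.
Qed.

(** * Upper bound on SRPT-k completion times *)

Section SRPT.
Variables (k : nat) (x par : 'I_n -> R) (a : schedule R n) (p : {perm 'I_n}).
Hypotheses (k1 : (1 <= k)%N) (x0 : forall j, 0 < x j) (par0 : forall j, 0 < par j).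
Hypotheses (fa : feasible k a)
  (serv : forall (i : 'I_n) t, 0 <= t -> serves k x par p a i t).

Lemma SRPT_le_par i t : 0 <= t -> a (p i) t <= par (p i).
Proof.
move=> t0; have [h1 h2] := serv i t0.
by case: (pselect (unfinished x par a (p i) t)) => [/h1|/h2] ->;
  rewrite ?ge_min ?lexx// ltW.
Qed.

Lemma SRPT_rate i t : 0 <= t -> rate par a (p i) t = a (p i) t.
Proof. by move=> t0; rewrite /rate min_r// SRPT_le_par. Qed.

(** A finished job gets no processors, so its work stops at its size; this caps each job's
    contribution when [SRPT_busy] is integrated. *)
Lemma SRPT_work_le i t : 0 <= t -> (work par a (p i) t <= (x (p i))%:E)%E.
Proof.
move=> t0; apply: (cumul_capped (rate_fun_rate (par0 _) fa) t0 (ltW (x0 _))).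
move=> s s0 xs; rewrite SRPT_rate//; apply: (serv i s0).2.
exact/finishedE.
Qed.

(* While job [p i] is unfinished, either it runs at its full rate [par (p i)]
   or the jobs of rank at most [i] occupy all [k] processors. *)
Lemma SRPT_busy i t : 0 <= t -> unfinished x par a (p i) t ->
  1 <= a (p i) t / par (p i) + k%:R^-1 * \sum_(l < n | (l <= i)%N) a (p l) t.
Proof.
move=> t0 /(serv i t0).1 ai; have k0 : 0 < k%:R :> R by rewrite ltr0n.
have [_ a0 _] := fa.
have S0 : 0 <= \sum_(l < n | (l <= i)%N) a (p l) t by apply: sumr_ge0 => l _; exact: a0.
have [pu|up] := leP (par (p i)) (unassigned k p a i t).
  rewrite ai min_l// divff ?gt_eqF// lerDl mulr_ge0// invr_ge0 ltW//.
rewrite [X in _ + _ * X](bigD1 i)//= (eq_bigl (fun l : 'I_n => (l < i)%N)); last first.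
  by move=> l; rewrite ltn_neqAle andbC.
rewrite [X in _ + _ * (X + _)]ai min_r ?(ltW up)// /unassigned subrK mulVf ?gt_eqF//.
by rewrite lerDr divr_ge0 ?a0// ltW.
Qed.

(** If the job were unfinished at [T = D + e], integrating [SRPT_busy] over [[0, T]] and bounding
    each work by the job size would give [T <= D]. *)
Lemma SRPT_completion_time_le i :
  (completion_time x par a (p i) <=
   (x (p i) / par (p i) + k%:R^-1 * \sum_(l < n | (l <= i)%N) x (p l))%:E)%E.
Proof.
have k0 : 0 < k%:R :> R by rewrite ltr0n.
set D := (X in X%:E); apply/lee_addgt0Pr => e e0.
have D0 : 0 <= D.
  apply: addr_ge0; first by rewrite divr_ge0// ltW.
  apply: mulr_ge0; first by rewrite invr_ge0 ltW.
  by apply: sumr_ge0 => l _; exact: ltW.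
pose T := D + e; have T0 : 0 <= T by rewrite addr_ge0// ltW.
apply: ge_ereal_inf; exists T%:E; last by rewrite -EFinD.
exists T => //; split=> // unf.
have : (T%:E <= D%:E)%E; last by rewrite lee_fin /T gerDl leNgt e0.
(* These weights write the right-hand side of [SRPT_busy] as one linear combination of the rates,
   and [D] as the same combination of the sizes. *)
pose c l : R := (l == i)%:R / par (p i) + k%:R^-1 * (l <= i)%N%:R.
have c0 l : 0 <= c l.
  by rewrite addr_ge0// ?divr_ge0 ?mulr_ge0 ?invr_ge0 ?ler0n// ltW.
have cE (y : 'I_n -> R) : \sum_l c l * y l =
    y i / par (p i) + k%:R^-1 * \sum_(l < n | (l <= i)%N) y l.
  rewrite (eq_bigr (fun l => (if l == i then y l / par (p i) else 0) +
      k%:R^-1 * (if (l <= i)%N then y l else 0))); last first.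
    move=> l _; rewrite /c mulrDl; case: eqP => _; case: (l <= i)%N;
      by rewrite ?mul1r ?mulr1 ?mul0r ?mulr0 ?mul0r// mulrC.
  by rewrite big_split/= -!big_mkcond big_pred1_eq -mulr_sumr -big_mkcond.
have rr l := rate_fun_rate (par0 (p l)) fa.
have -> : T%:E = cumul (cst 1) T by rewrite cumul_cst// mul1r.
apply: (@le_trans _ _ (cumul (fun s => \sum_l c l * rate par a (p l) s) T)).
  apply: le_cumul_fun (rate_fun_cst ler01) (rate_fun_lincomb c0 rr) _.
  move=> s /andP[s0 sT].
  rewrite (eq_bigr (fun l => c l * a (p l) s)); last first.
    by move=> l _; rewrite SRPT_rate.
  rewrite (cE (fun l => a (p l) s)); apply: SRPT_busy => //.
  (* Work is nondecreasing, so a job unfinished at [T] is unfinished at every [s <= T]. *)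
  by apply: le_lt_trans unf; exact: le_cumul (rr i) sT.
rewrite (cumul_lincomb _ c0 rr) -[D](cE (fun l => x (p l))) -sumEFin.
apply: lee_sum => l _; rewrite EFinM lee_wpmul2l ?lee_fin//.
exact: SRPT_work_le.
Qed.

End SRPT.

(** * Comparison with the optimum *)

Lemma SRPT_total_response_le k x par a b : (1 <= k)%N -> (forall j, 0 < x j) ->
  (forall j, 0 < par j) -> is_SRPT k x par a -> feasible k b ->
  (total_response x par a <= 2%:E * total_response x par b)%E.
Proof.
move=> k1 x0 par0 [fa [p px serv]] fb.
have k0 : 0 < k%:R :> R by rewrite ltr0n.
have totE s : total_response x par s = (\sum_i completion_time x par s (p i))%E.
  exact: (reindex_inj (@perm_inj _ p)).
have span : ((\sum_i x (p i) / par (p i))%:E <= total_response x par b)%E.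
  rewrite totE -sumEFin; apply: lee_sum => i _.
  exact: completion_time_ge_span (par0 _) fb.
have load : ((k%:R^-1 * \sum_(i < n) \sum_(l < n | (l <= i)%N) x (p l))%:E
    <= total_response x par b)%E.
  (* The order in which [b] completes the jobs, transported to ranks; it is total, and sizes
     increase with rank, so [sorted_order_minimal] applies. *)
  pose e := fun l i : 'I_n =>
    (completion_time x par b (p l) <= completion_time x par b (p i))%E.
  have etot : total e by move=> l i; exact: le_total.
  apply: (@le_trans _ _ (k%:R^-1 * \sum_i \sum_(l | e l i) x (p l))%:E).
    rewrite lee_fin ler_pM2l ?invr_gt0//.
    by apply: sorted_order_minimal => // i; exact: ltW.
  rewrite totE mulr_sumr -sumEFin; apply: lee_sum => i _.
  have := completion_time_ge_load x (p i) k1 par0 fb.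
  by rewrite (reindex_inj (@perm_inj _ p)).
have -> : (2%:E * total_response x par b =
    total_response x par b + total_response x par b)%E.
  by rewrite -mule2n mule_natl.
apply: le_trans (leeD span load); rewrite -EFinD totE mulr_sumr -big_split/= -sumEFin.
by apply: lee_sum => i _; exact: SRPT_completion_time_le.
Qed.

Lemma total_response_ge0 x par a : (0 <= total_response x par a)%E.
Proof.
by apply: sume_ge0 => j _; apply: le_ereal_inf_tmp => _ [t [t0 _] <-]; rewrite lee_fin.
Qed.

(** After division by 4, [c / 4] is a lower bound of all feasible costs, hence of their infimum. *)
Lemma le_optimum k (cost : schedule R n -> \bar R) (c : \bar R) :
  (forall b, feasible k b -> (c <= 4%:E * cost b)%E) ->
  (c <= 4%:E * optimum k cost)%E.
Proof.
move=> h; rewrite -lee_pdivrMl//; apply: le_ereal_inf_tmp => _ [b fb <-].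
by rewrite lee_pdivrMl// h.
Qed.

End Scheduling.

Theorem theorem9 (R : realType) (k n : nat) (x par : 'I_n -> R)
    (k_ge1 : (1 <= k)%N)
    (x_gt0 : forall j : 'I_n, 0 < x j)
    (par_bounds : forall j : 'I_n, 0 < par j <= k%:R) :
  (exists a : schedule R n, is_SRPT k x par a) /\
  (forall a : schedule R n, is_SRPT k x par a ->
     (total_response x par a <= 4%:E * optimum k (total_response x par))%E /\
     (mean_response x par a <= 4%:E * optimum k (mean_response x par))%E).
Proof.
have par0 j : 0 < par j by case/andP: (par_bounds j).
split=> [|a srpt]; first exact: exists_SRPT.
have H b : feasible k b ->
    (total_response x par a <= 4%:E * total_response x par b)%E.
  move=> fb; apply: le_trans (SRPT_total_response_le k_ge1 x_gt0 par0 srpt fb) _.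
  (* Weakening the factor 2 to 4 relies on the total response being nonnegative. *)
  by rewrite lee_wpmul2r ?total_response_ge0// lee_fin ler_nat.
split; apply: le_optimum => b /H// {}H.
(* For [n = 0] the factor [n%:R^-1] is 0 by convention, which is still nonnegative. *)
by rewrite /mean_response muleCA lee_wpmul2l// lee_fin invr_ge0.
Qed.
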